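(* Let $R$ be a Baer $*$-ring and let $\{F_i\}_{i\in I}$ be a family of functions $F_i:R^n\to R$ (with $n$ not necessarily finite) such that $F_i(q\mathbf{x})=qF_i(\mathbf{x})$ for every $i\in I$, every $\mathbf{x}=\{x_j\}_j\in R^n$ and every projection $q\in\mathbf{x}'$, where $q\mathbf{x}=\{qx_j\}_j$. Say that $\mathbf{x}\in R^n$ has the property $\mathcal{P}_I$ if $F_i(\mathbf{x})=0$ for all $i\in I$. Then for every $\mathbf{x}\in R^n$ there is a unique projection $p\in\mathbf{x}'$ such that $p\mathbf{x}$ has the property $\mathcal{P}_I$ and $(1-p)\mathbf{x}$ completely does not have the property $\mathcal{P}_I$.
   Context: A Baer $*$-ring is a ring $R$ with unity $1$ and an involution $*$ such that the right annihilator of every subset of $R$ is a principal right ideal generated by a projection (self-adjoint idempotent). Projections are ordered by $p\le q$ iff $pq=p$. For $\mathbf{x}=\{x_j\}_j\in R^n$, $\mathbf{x}'=\{r\in R: rx_j=x_jr \text{ for all } j\}$ is the commutant. For a projection $p\in\mathbf{x}'$, the compression $p\mathbf{x}$ is regarded as a tuple in the corner $pRp$ (a ring with unity $p$). An object completely does not have a property if no compression of it by a nonzero projection commuting with it has the property; for $(1-p)\mathbf{x}$ this is understood in the corner $(1-p)R(1-p)$, i.e. for every nonzero projection $r\le 1-p$ with $r$ commuting with all entries of $(1-p)\mathbf{x}$, the compression $r\mathbf{x}$ does not have the property. *)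

(* Defs.v *)
From HB Require Import structures.
From mathcomp Require Import all_boot all_algebra.
From mathcomp Require Import classical_sets.

Set Implicit Arguments.
Unset Strict Implicit.
Unset Printing Implicit Defensive.

Import GRing.Theory.
Local Open Scope ring_scope.
Local Open Scope classical_set_scope.

HB.mixin Record isStarRing R of GRing.PzRing R := {
  star : R -> R;
  starD : forall x y, star (x + y) = star x + star y;
  starM : forall x y, star (x * y) = star y * star x;
  starK : forall x, star (star x) = x
}.

#[short(type="starRingType")]
HB.structure Definition StarRing := {R of GRing.PzRing R & isStarRing R}.

Definition projection (R : starRingType) (p : R) : Prop :=
  star p = p /\ p * p = p.

Definition right_annihilator (R : pzRingType) (S : set R) : set R :=
  [set r | forall s, S s -> s * r = 0].

Definition principal_right_ideal (R : pzRingType) (a : R) : set R :=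
  [set a * r | r in [set: R]].

HB.mixin Record StarRing_isBaer R of StarRing R := {
  baerP : forall S : set R, exists2 p : R,
    projection p & right_annihilator S = principal_right_ideal p
}.

#[short(type="baerStarRingType")]
HB.structure Definition BaerStarRing := {R of StarRing_isBaer R & StarRing R}.

Definition proj_le (R : pzRingType) (p q : R) : Prop := p * q = p.

(* Tuples are functions from an arbitrary index type, finite or not. *)
Definition commutant (R : pzRingType) (J : Type) (x : J -> R) : set R :=
  [set r | forall j, r * x j = x j * r].

Definition compress (R : pzRingType) (J : Type) (q : R) (x : J -> R) : J -> R :=
  fun j => q * x j.

Definition vanishes (R : pzRingType) (I J : Type) (F : I -> (J -> R) -> R)
    (x : J -> R) : Prop :=
  forall i, F i x = 0.

(* [y] is viewed as a tuple in the corner [e R e]: only the projections of that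
   corner, that is those below its unit [e], are used to compress it. *)
Definition completely_not (R : starRingType) (J : Type)
    (P : (J -> R) -> Prop) (e : R) (y : J -> R) : Prop :=
  forall r : R, projection r -> r != 0 -> proj_le r e -> commutant y r ->
    ~ P (compress r y).

(* Main.v *)
Require Import Defs.
From HB Require Import structures.
From mathcomp Require Import all_boot all_algebra.
From mathcomp Require Import classical_sets.

Import GRing.Theory.
Local Open Scope ring_scope.

(** Homogeneity turns both halves of the conclusion into annihilation: for a
    projection [q] commuting with [x], the compression [q x] has the property
    exactly when [q] kills every value [F i x].  So let [Q] be the set of
    projections that commute with [x] and kill all [F i x]; the projection [p]
    to be found is the supremum of [Q], and the point is that it lies in [Q].

    The Baer condition writes the right annihilator of [Q] as [e R] with [e] a
    projection, and [p] is [1 - e].  Each [F i x] belongs to this annihilator,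
    so [e] fixes it and [p] kills it.  The annihilator of a set commuting with
    [x j] is stable under left multiplication by [x j], and, since projections
    are self-adjoint, also by [star (x j)]; this makes [e], hence [p], commute
    with [x] ([baer_annihilator_commute]).

    A projection [r <= e] that compresses [e x] to a tuple with the property
    also commutes with [x], so it lies in [Q] ([completely_notP]); but then
    [r = r e = 0].  Finally, any other solution [p'] lies in [Q], hence below
    [p], and [p - p'] is a projection below [1 - p'] in [Q], so it is zero. *)

Lemma star1 (R : starRingType) : star (1 : R) = 1.
Proof.
have h : star (star (1 : R) * 1) = star 1 * 1 by rewrite starM starK mulr1.
by rewrite -[LHS]mulr1 -h mulr1 starK.
Qed.

Lemma star_sub (R : starRingType) (a b : R) : star (a - b) = star a - star b.
Proof. by apply/eqP; rewrite -subr_eq opprK -starD subrK. Qed.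

(** Since [p] and [q] are self-adjoint, [p q] is the star of [q p = q]. *)
Lemma projection_absorbC {R : starRingType} {p q : R} :
  projection p -> projection q -> q * p = q -> p * q = q.
Proof. by move=> [sp _] [sq _] qp; rewrite -{1}sp -{1}sq -starM qp. Qed.

Lemma projection_sub (R : starRingType) (p q : R) :
  projection p -> projection q -> q * p = q -> projection (p - q).
Proof.
move=> pP qP qp; have pq := projection_absorbC pP qP qp.
case: pP qP => [sp pp] [sq qq].
split; first by rewrite star_sub sp sq.
by rewrite mulrBl !mulrBr pp pq qp qq subrr subr0.
Qed.

Lemma projection1 (R : starRingType) : projection (1 : R).
Proof. by split; [exact: star1 | exact: mulr1]. Qed.

Lemma projection_compl {R : starRingType} {p : R} :
  projection p -> projection (1 - p).
Proof. by move=> pp; apply: projection_sub (projection1 R) pp (mulr1 p). Qed.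

Lemma commutant_sub (R : pzRingType) (J : Type) (x : J -> R) (a b : R) :
  commutant x a -> commutant x b -> commutant x (a - b).
Proof. by move=> xa xb j; rewrite mulrBl mulrBr xa xb. Qed.

Lemma commutant1 (R : pzRingType) (J : Type) (x : J -> R) : commutant x 1.
Proof. by move=> j; rewrite mul1r mulr1. Qed.

(** As [e] is idempotent, membership in [e R] is the equation [e * a = a]. *)
Lemma baer_annihilatorP {R : starRingType} {S : set R} {e : R} :
  projection e -> right_annihilator S = principal_right_ideal e ->
  forall a, (forall s, S s -> s * a = 0) <-> e * a = a.
Proof.
move=> [_ ee] Se a; have -> : (forall s, S s -> s * a = 0) =
  principal_right_ideal e a by rewrite -Se.
by split=> [[b _ <-]|<-]; [rewrite mulrA ee | exists a].
Qed.

(** The annihilator [e R] is stable under left multiplication by [y] and by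
    [star y], that is [e y e = y e] and [e (star y) e = (star y) e]; the star of
    the second equation, [e y e = e y], together with the first gives
    [e y = y e]. *)
Lemma baer_annihilator_commute {R : starRingType} {S : set R} {e y : R} :
  projection e -> right_annihilator S = principal_right_ideal e ->
  (forall s, S s -> projection s /\ s * y = y * s) ->
  e * y = y * e.
Proof.
move=> pe Se Sy; have [se ee] := pe.
have annP := baer_annihilatorP pe Se.
have Se0 s : S s -> s * e = 0 by move: s; apply/annP.
have stable z : (forall s, S s -> s * z = z * s) -> e * (z * e) = z * e.
  by move=> Sz; apply/annP => s Ss; rewrite mulrA Sz// -mulrA Se0// mulr0.
have eye : e * (y * e) = y * e by apply: stable => s /Sy[].
have eye' : e * (star y * e) = star y * e.
  apply: stable => s /Sy[[ss _] sy].
  by rewrite -[in LHS]ss -starM -sy starM ss.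
by move/(congr1 (@star R)): eye'; rewrite !starM starK se -mulrA eye => ->.
Qed.

(** A projection [r <= e] commuting with [e x] commutes with [x] itself, because
    [r = r e = e r]; this lets the corner of [e] be described by elements of the
    whole ring. *)
Lemma completely_notP {R : starRingType} {I J : Type}
    {F : I -> (J -> R) -> R}
    (hF : forall (i : I) (x : J -> R) (q : R),
        projection q -> commutant x q ->
        F i (compress q x) = q * F i x)
    {x : J -> R} {e : R} :
  projection e -> commutant x e ->
  completely_not (vanishes F) e (compress e x) <->
  (forall r, projection r -> r * e = r -> commutant x r ->
     (forall i, r * F i x = 0) -> r = 0).
Proof.
move=> pe xe; have er r := @projection_absorbC _ e r pe.
have comP r : projection r -> r * e = r ->
    commutant (compress e x) r <-> commutant x r.
  move=> pr re; split=> xr j; move: (xr j); rewrite /compress.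
    by rewrite mulrA re xe -mulrA er//.
  by rewrite mulrA re xe -mulrA er//.
have FP r i : projection r -> r * e = r -> commutant (compress e x) r ->
    F i (compress r (compress e x)) = r * F i x.
  by move=> pr re xr; rewrite hF// hF// mulrA re.
split=> [cn r pr re xr Fr | cn r pr r0 re xr Fr].
  apply/eqP; apply/negPn/negP => r0.
  have xr' : commutant (compress e x) r by apply/comP.
  by apply: (cn r pr r0 re xr') => i; rewrite FP.
move/eqP: r0; apply; apply: cn => //; first exact/comP.
by move=> i; rewrite -FP.
Qed.

Theorem theorem2p5 (R : baerStarRingType) (I J : Type)
    (F : I -> (J -> R) -> R)
    (hF : forall (i : I) (x : J -> R) (q : R),
        projection q -> commutant x q ->
        F i (compress q x) = q * F i x)
    (x : J -> R) :
  exists! p : R,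
    projection p /\ commutant x p /\
    vanishes F (compress p x) /\
    completely_not (vanishes F) (1 - p) (compress (1 - p) x).
Proof.
pose Q : set R := fun q =>
  [/\ projection q, commutant x q & forall i, q * F i x = 0].
have [e pe Qe] := baerP Q.
have annP := baer_annihilatorP pe Qe.
have Qe0 q : Q q -> q * e = 0 by move: q; apply/annP; case: pe.
have xe : commutant x e.
  by move=> j; apply: (baer_annihilator_commute pe Qe) => q [pq xq _].
have eF i : e * F i x = F i x by apply/annP => q [].
have pp := projection_compl pe.
have xp : commutant x (1 - e) by apply: commutant_sub xe; apply: commutant1.
have pF i : (1 - e) * F i x = 0 by rewrite mulrBl mul1r eF subrr.
exists (1 - e); split.
  split=> //; split=> //; split; first by move=> i; rewrite hF.
  rewrite subKr; apply/(completely_notP hF) => // r pr re xr Fr.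
  by rewrite -re Qe0.
move=> p' [pp' [xp' [Fp' cn]]].
have p'F i : p' * F i x = 0 by rewrite -hF.
have p'p : p' * (1 - e) = p' by rewrite mulrBr mulr1 Qe0// subr0.
have xp'c : commutant x (1 - p').
  by apply: commutant_sub xp'; apply: commutant1.
move/(completely_notP hF (projection_compl pp') xp'c): cn => cn.
apply/subr0_eq/cn.
- exact: projection_sub.
- have pp'E := projection_absorbC pp pp' p'p.
  by case: pp' => _ p'2; rewrite mulrBr mulr1 mulrBl pp'E p'2 subrr subr0.
- exact: commutant_sub.
- by move=> i; rewrite mulrBl pF p'F subr0.
Qed.
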